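(* Let $X$ be a uniformly convex Banach space, let $A_1,\dots,A_m$ be nonempty subsets of $X$, let $1\le p\le\infty$, let $\varphi:[0,\infty)\to[0,\infty)$ be strictly increasing, and let $T:\bigcup_{i=1}^m A_i\to\bigcup_{i=1}^m A_i$ be a cyclic $p$-$\varphi$-contraction. Let $x_0\in A_1$ and $x_n=Tx_{n-1}$ for $n\ge1$. Suppose that $A_{i_0}$ is a closed convex subset of $X$ for some $i_0\in\{1,\dots,m\}$. If $d_p(A_1,\dots,A_m)=0$, then $T$ has a unique fixed point $x\in\bigcap_{i=1}^m A_i$, and $x_n\to x$ as $n\to\infty$.
   Context: Here $m$ is a positive integer, indices of the sets are cyclic ($A_{m+1}=A_1$), $d(x,y)=\|x-y\|$, and $d(A,B)=\inf\{d(a,b):a\in A,b\in B\}$. For $1\le p<\infty$, $d_p(A_1,\dots,A_m)=\left(\sum_{i=1}^m d(A_i,A_{i+1})^p\right)^{1/p}$, and $d_\infty(A_1,\dots,A_m)=\max_{1\le i\le m} d(A_i,A_{i+1})$. For points $x_1,\dots,x_m,y_1,\dots,y_m\in X$ with $y_{m+1}=y_1$, $d_p(x_1,\dots,x_m;y_1,\dots,y_m)=\left(\sum_{i=1}^m d(x_i,y_{i+1})^p\right)^{1/p}$ for $1\le p<\infty$, and $d_\infty(x_1,\dots,x_m;y_1,\dots,y_m)=\max_{1\le i\le m} d(x_i,y_{i+1})$. A map $T:\bigcup_i A_i\to\bigcup_i A_i$ is a cyclic $p$-$\varphi$-contraction if $T(A_i)\subset A_{i+1}$ for $i=1,\dots,m$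 and, for all $x_i,y_i\in A_i$ ($i=1,\dots,m$), $$d_p(Tx_1,\dots,Tx_m;Ty_1,\dots,Ty_m)\le d_p(x_1,\dots,x_m;y_1,\dots,y_m)-\varphi\big(d_p(x_1,\dots,x_m;y_1,\dots,y_m)\big)+\varphi\big(d_p(A_1,\dots,A_m)\big).$$ A Banach space $X$ is uniformly convex if there is a strictly increasing function $\delta:(0,2]\to[0,1]$ such that for all $x,y,w\in X$, $R>0$ and $r\in[0,2R]$: if $\|x-w\|\le R$, $\|y-w\|\le R$ and $\|x-y\|\ge r$, then $\left\|\frac{x+y}{2}-w\right\|\le\left(1-\delta(r/R)\right)R$ (understood for $r>0$, where $\delta(r/R)$ is defined). *)

(* Defs.v *)
From HB Require Import structures.
From mathcomp Require Import all_boot all_order all_algebra.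
From mathcomp Require Import all_classical all_reals all_analysis.

Set Implicit Arguments.
Unset Strict Implicit.
Unset Printing Implicit Defensive.

Import Order.TTheory GRing.Theory Num.Theory.
Import numFieldNormedType.Exports.

Local Open Scope classical_set_scope.
Local Open Scope ring_scope.

Section cyclic_contractions.
Context {R : realType} {X : normedModType R}.

Definition set_dist (A B : set X) : R :=
  inf [set `|a - b| | a in A & b in B].

(* Meant for nonnegative u and 1 <= p only: the base value 0 of the maximum is
   then harmless, and the value at p = -oo is junk. *)
Definition lp_norm (m : nat) (p : \bar R) (u : 'I_m -> R) : R :=
  match p with
  | r%:E => (\sum_i u i `^ r) `^ r^-1
  | +oo%E => \big[Num.max/0]_i u i
  | -oo%E => 0
  end.

(* ordS is the successor on 'I_m that wraps around. *)
Definition dp_sets (m : nat) (p : \bar R) (A : 'I_m -> set X) : R :=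
  lp_norm p (fun i => set_dist (A i) (A (ordS i))).

Definition dp_points (m : nat) (p : \bar R) (x y : 'I_m -> X) : R :=
  lp_norm p (fun i => `|x i - y (ordS i)|).

Definition cyclic_p_phi_contraction (m : nat) (p : \bar R) (phi : R -> R)
    (A : 'I_m -> set X) (T : X -> X) : Prop :=
  (forall i, T @` A i `<=` A (ordS i)) /\
  (forall x y : 'I_m -> X, (forall i, A i (x i)) -> (forall i, A i (y i)) ->
    dp_points p (T \o x) (T \o y) <=
      dp_points p x y - phi (dp_points p x y) + phi (dp_sets p A)).

End cyclic_contractions.

Definition uniformly_convex (R : realType) (X : normedModType R) : Prop :=
  exists delta : R -> R,
    [/\ {in `]0, 2] &, {homo delta : s t / s < t}},
        forall t, t \in `]0, 2] -> delta t \in `[0, 1]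
      & forall (x y w : X) (rho r : R), 0 < rho -> 0 < r -> r <= 2 * rho ->
          `|x - w| <= rho -> `|y - w| <= rho -> r <= `|x - y| ->
          `|2^-1 *: (x + y) - w| <= (1 - delta (r / rho)) * rho].

(* Main.v *)
(* As all the distances between consecutive sets vanish, the p-contraction
   reduces to [d(Ta, Tb) <= d(a, b) - psi (d(a, b))] for every pair of points in
   consecutive sets, with [psi t = phi t - phi 0] positive for [t > 0].  Hence
   the steps [d(x_n, x_(n+1))] tend to 0 and the orbit is Cauchy.  Its limit lies
   in the closed set [A i0], since the orbit visits it infinitely often, and is
   fixed because [T] is nonexpansive between [A i0] and the next set. *)

Require Import Defs.
From HB Require Import structures.
From mathcomp Require Import all_boot all_order all_algebra.
From mathcomp Require Import all_classical all_reals all_analysis.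
From mathcomp Require Import lra.

Set Implicit Arguments.
Unset Strict Implicit.
Unset Printing Implicit Defensive.

Import Order.TTheory GRing.Theory Num.Theory.
Import numFieldNormedType.Exports.

Local Open Scope classical_set_scope.
Local Open Scope ring_scope.

(** * Comparison of the $p$-norm with the coordinates and with their sum *)

Lemma lp_norm_ge_coord (R : realType) (m : nat) (p : \bar R) (u : 'I_m -> R)
    (i : 'I_m) :
  (1 <= p)%E -> (forall j, 0 <= u j) -> u i <= lp_norm p u.
Proof.
case: p => [r| |] //= p1 u0; last exact: le_bigmax.
have r1 : 1 <= r by rewrite -lee_fin.
have r0 : 0 < r by exact: lt_le_trans r1.
rewrite -{1}[u i]powRr1 // -(@mulfV _ r) ?gt_eqF // powRrM.
apply: ge0_ler_powR.
- by rewrite invr_ge0 ltW.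
- exact: powR_ge0.
- by rewrite nnegrE; apply: sumr_ge0 => j _; exact: powR_ge0.
- rewrite (bigD1 i) //= lerDl; apply: sumr_ge0 => j _; exact: powR_ge0.
Qed.

(** With $S = \sum_i u_i$ and $p = r$ finite, $u_i^r = u_i u_i^{r-1} \le u_i S^{r-1}$ because $u_i
    \le S$ and $r \ge 1$; summing over $i$ gives $S^r$. *)
Lemma lp_norm_le_sum (R : realType) (m : nat) (p : \bar R) (u : 'I_m -> R) :
  (1 <= p)%E -> (forall j, 0 <= u j) -> lp_norm p u <= \sum_i u i.
Proof.
have le_sum i : (forall j, 0 <= u j) -> u i <= \sum_j u j.
  by move=> u0; rewrite (bigD1 i) //= lerDl; apply: sumr_ge0 => j _; exact: u0.
case: p => [r| |] //= p1 u0; last first.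
  by apply: bigmax_le => [|i _]; [exact: sumr_ge0 | exact: le_sum].
have r1 : 1 <= r by rewrite -lee_fin.
have r0 : 0 < r by exact: lt_le_trans r1.
have S0 : 0 <= \sum_i u i by exact: sumr_ge0.
rewrite -[leRHS]powRr1 // -(@mulfV _ r) ?gt_eqF // powRrM.
apply: ge0_ler_powR.
- by rewrite invr_ge0 ltW.
- by rewrite nnegrE; apply: sumr_ge0 => j _; exact: powR_ge0.
- exact: powR_ge0.
have powRE x : 0 <= x -> x `^ r = x * x `^ (r - 1).
  move=> x0; have [->|xN0] := eqVneq x 0; first by rewrite mul0r powR0 ?gt_eqF.
  rewrite -{2}[x]powRr1 // -powRD ?xN0 ?implybT //.
  by rewrite addrC subrK.
rewrite powRE // mulr_suml; apply: ler_sum => i _.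
rewrite powRE //; apply: ler_wpM2l => //.
by apply: ge0_ler_powR; rewrite ?subr_ge0 ?nnegrE // le_sum.
Qed.

(** * Distances between sets *)

Section distance_between_sets.
Context {R : realType} {X : normedModType R}.
Implicit Types A B : set X.

Lemma set_dist_has_inf A B : A !=set0 -> B !=set0 ->
  has_inf [set `|a - b| | a in A & b in B].
Proof.
move=> [a Aa] [b Bb]; split; first by exists `|a - b|, a => //; exists b.
by exists 0 => _ [x _ [y _ <-]].
Qed.

Lemma set_dist_ge0 A B : A !=set0 -> B !=set0 -> 0 <= set_dist A B.
Proof.
move=> A0 B0; apply: lb_le_inf; first by case: (set_dist_has_inf A0 B0).
by move=> _ [x _ [y _ <-]].
Qed.

Lemma set_dist0_near A B (e : R) : A !=set0 -> B !=set0 ->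
  set_dist A B = 0 -> 0 < e ->
  exists2 ab : X * X, A ab.1 /\ B ab.2 & `|ab.1 - ab.2| < e.
Proof.
move=> A0 B0 AB e0; have AB_inf := set_dist_has_inf A0 B0.
have [_ [a Aa [b Bb <-]]] := inf_adherent e0 AB_inf.
by rewrite -/(set_dist A B) AB add0r; exists (a, b).
Qed.

End distance_between_sets.

(** * Walking around the cycle of indices *)

Lemma val_iter_ordS (m : nat) (i : 'I_m) n :
  val (iter n (@ordS m) i) = ((i + n) %% m)%N.
Proof.
elim: n => [|n IHn]; first by rewrite addn0 modn_small.
by rewrite iterS /= IHn -addn1 modnDml addn1 addnS.
Qed.

Lemma iter_ordSDM (m : nat) (i : 'I_m) n k :
  iter (n + k * m) (@ordS m) i = iter n (@ordS m) i.
Proof. by apply: val_inj; rewrite !val_iter_ordS addnA addnC modnMDl. Qed.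

Lemma iter_ordS_ge (m : nat) (i j : 'I_m) N :
  exists2 n, (N <= n)%N & iter n (@ordS m) i = j.
Proof.
have m0 : (0 < m)%N by apply: leq_ltn_trans (ltn_ord i).
(* Going [m - i] steps from [i] closes the turn at index 0, and [j] more steps reach [j]; the [N]
   extra full turns only make the count at least [N]. *)
exists (j + (m - i) + N * m)%N.
  by apply: leq_trans (leq_addl _ _); exact: leq_pmulr.
apply: val_inj; rewrite iter_ordSDM val_iter_ordS.
by rewrite addnCA subnKC 1?ltnW // modnDr modn_small.
Qed.

(** * Scalar recursion and contraction of a single pair *)

(** While [d n >= e], each step loses at least the fixed amount [psi e > 0], so nonnegativity forces
    some [d N < e]; from there on [d] does not increase. *)
Lemma decreasing_by_cvg0 (R : realType) (psi : R -> R) (d : nat -> R) (e : R) :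
  (forall s t, 0 <= s -> s <= t -> psi s <= psi t) ->
  (forall t, 0 < t -> 0 < psi t) -> 0 <= psi 0 ->
  (forall n, 0 <= d n) -> (forall n, d n.+1 <= d n - psi (d n)) -> 0 < e ->
  exists N, forall n, (N <= n)%N -> d n < e.
Proof.
move=> psi_mono psi_gt0 psi0 d0 dS e0.
have psi_ge0 t : 0 <= t -> 0 <= psi t.
  by move=> t0; exact: le_trans psi0 (psi_mono _ _ _ t0).
have [N dN] : exists N, d N < e.
  apply: contrapT => /forallNP/= dN.
  have de n : e <= d n by rewrite leNgt; apply/negP/dN.
  have dn n : d n <= d 0%N - psi e *+ n.
    elim: n => [|n IHn]; first by rewrite subr0.
    apply: (le_trans (dS n)).
    by rewrite mulrS opprD addrCA addrC lerB // psi_mono // ltW.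
  have := archi_boundP (divr_ge0 (d0 0%N) (ltW (psi_gt0 _ e0))).
  rewrite ltr_pdivrMr ?psi_gt0 // mulr_natl => lt_d0.
  by have := le_trans (d0 _) (dn (Num.bound (d 0%N / psi e))); lra.
exists N => n /subnK <-; elim: (n - N)%N => [//|k IHk].
rewrite addSn; apply: le_lt_trans IHk; apply: (le_trans (dS _)).
by rewrite gerBl psi_ge0.
Qed.

(* Since all the set distances vanish, the other m - 1 pairs entering
   [dp_points] can be taken arbitrarily close, which removes [p]. *)
Lemma cyclic_contraction_pair (R : realType) (X : normedModType R) (m : nat)
    (A : 'I_m -> set X) (p : \bar R) (phi : R -> R) (T : X -> X) :
  (forall i, A i !=set0) -> (1 <= p)%E ->
  {in `[0, +oo[ &, {homo phi : s t / s < t}} ->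
  cyclic_p_phi_contraction p phi A T -> dp_sets p A = 0 ->
  forall i a b, A i a -> A (ordS i) b ->
    `|T a - T b| <= `|a - b| - (phi `|a - b| - phi 0).
Proof.
move=> A0 p1 phi_incr [_ T_contr] dp0 i a b Aa Ab.
have phi_mono : {in `[0, +oo[ &, {homo phi : s t / s <= t}}.
  move=> s t s0 t0; rewrite le_eqVlt => /predU1P[-> //|st].
  exact/ltW/phi_incr.
have dA0 j : set_dist (A j) (A (ordS j)) = 0.
  apply/eqP; rewrite eq_le set_dist_ge0 // andbT -dp0.
  by apply: (lp_norm_ge_coord (u := fun k => set_dist (A k) (A (ordS k)))) => // k;
    exact: set_dist_ge0.
apply/ler_addgt0Pr => e e0.
(* At most [m] pairs other than the one at [i] are chosen, so together they contribute at most
   [e]. *)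
have em0 : 0 < e / m.+1%:R by rewrite divr_gt0.
have near j := set_dist0_near (A0 j) (A0 (ordS j)) (dA0 j) em0.
pose c j : X * X := if j == i then (a, b) else s2val (cid2 (near j)).
have Ac j : A j (c j).1 /\ A (ordS j) (c j).2.
  by rewrite /c; case: eqVneq => [->//|_]; case: (cid2 (near j)).
pose x j := (c j).1.
(* [dp_points] compares [x j] with [y (ordS j)], so the second point of the pair [c j] is stored at
   index [ordS j]. *)
pose y j := (c (ord_pred j)).2.
have xyE j : `|x j - y (ordS j)| = `|(c j).1 - (c j).2| by rewrite /x /y ordSK.
have ci : c i = (a, b) by rewrite /c eqxx.
have Ax j : A j (x j) by case: (Ac j).
have Ay j : A j (y j).
  by rewrite -[j in A j]ord_predK; case: (Ac (ord_pred j)).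
have le_ab : `|a - b| <= dp_points p x y.
  apply: le_trans (lp_norm_ge_coord (u := fun j => `|x j - y (ordS j)|) i p1 _) => //.
  by rewrite xyE ci.
have le_Tab : `|T a - T b| <= dp_points p (T \o x) (T \o y).
  apply: le_trans (lp_norm_ge_coord
    (u := fun j => `|(T \o x) j - (T \o y) (ordS j)|) i p1 _) => //.
  by rewrite /= /x /y ordSK ci.
have dp_le : dp_points p x y <= `|a - b| + e.
  apply: le_trans (lp_norm_le_sum p1 _) _ => //.
  rewrite (bigD1 i) //= xyE ci lerD2l.
  apply: (@le_trans _ _ (\sum_(j < m | j != i) e / m.+1%:R)).
    apply: ler_sum => j /negbTE ji; rewrite xyE /c ji.
    by case: (cid2 (near j)) => ? /= _ /ltW.
  rewrite sumr_const -[_ *+ #|_|]mulr_natr mulrAC ler_pdivrMr //.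
  rewrite ler_wpM2l ?ler_nat //; first exact: ltW.
  by apply: leqW; apply: leq_trans (max_card _) _; rewrite card_ord.
(* Monotonicity suffices: the positive term is bounded above through [dp_le], while the subtracted
   [phi] term is bounded below by its value at [|a - b|]. *)
have phi_le : phi `|a - b| <= phi (dp_points p x y).
  by apply: phi_mono => //; rewrite in_itv /= andbT // (le_trans _ le_ab).
have := T_contr x y Ax Ay; rewrite dp0 => Txy.
by lra.
Qed.

(** * The orbit is Cauchy *)

Section cyclic_orbit.
Context {R : realType} {X : normedModType R}.
Variables (m : nat) (A : 'I_m -> set X) (T : X -> X) (psi : R -> R).
Hypothesis TA : forall i, T @` A i `<=` A (ordS i).
Hypothesis psi_mono : forall s t, 0 <= s -> s <= t -> psi s <= psi t.
Hypothesis psi_gt0 : forall t, 0 < t -> 0 < psi t.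
Hypothesis psi0 : 0 <= psi 0.
Hypothesis T_pair : forall i a b, A i a -> A (ordS i) b ->
  `|T a - T b| <= `|a - b| - psi `|a - b|.
Variables (i1 : 'I_m) (x_ : nat -> X).
Hypothesis x0 : A i1 (x_ 0%N).
Hypothesis x_rec : forall n, x_ n.+1 = T (x_ n).

Lemma orbit_mem n : A (iter n (@ordS m) i1) (x_ n).
Proof. by elim: n => // n IHn; rewrite x_rec; apply: TA; exists (x_ n). Qed.

Lemma orbit_step_small (e : R) : 0 < e ->
  exists N, forall n, (N <= n)%N -> `|x_ n - x_ n.+1| < e.
Proof.
apply: (@decreasing_by_cvg0 _ psi (fun n => `|x_ n - x_ n.+1|)) => // n.
rewrite !x_rec; apply: T_pair (orbit_mem n) _.
by have := orbit_mem n.+1; rewrite x_rec.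
Qed.

Lemma orbit_drift (e : R) N : (forall n, (N <= n)%N -> `|x_ n - x_ n.+1| <= e) ->
  forall n k, (N <= n)%N -> `|x_ n - x_ (n + k)%N| <= e *+ k.
Proof.
move=> stepN n k Nn; elim: k => [|k IHk]; first by rewrite addn0 subrr normr0.
rewrite mulrSr addnS; apply: le_trans (ler_distD (x_ (n + k)%N) _ _) _.
by apply: lerD => //; apply: stepN; exact: leq_trans (leq_addr _ _).
Qed.

(* The points [x_ n] and [x_ (n + 1 + j m)] lie in consecutive sets, so their
   distance [s] is contracted: it passes to [s - psi s] plus a drift [<= psi e]. *)
Lemma orbit_close (e : R) : 0 < e ->
  exists N, forall n k, (N <= n)%N -> `|x_ n - x_ (n + k)%N| <= 3 * e.
Proof.
move=> e0.
(* Up to [m] steps of size [d] drift by at most [e], and also by at most [psi e], the least loss of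
   a distance that is at least [e]. *)
pose d := Num.min e (psi e) / m.+1%:R.
have d0 : 0 < d by rewrite divr_gt0 // lt_min e0 psi_gt0.
have [N stepN] := orbit_step_small d0.
have drift := orbit_drift (fun n Nn => ltW (stepN n Nn)).
have dm k : (k <= m)%N -> d *+ k <= Num.min e (psi e).
  move=> km; rewrite -mulr_natr /d mulrAC ler_pdivrMr //.
  by rewrite ler_wpM2l ?ler_nat ?(leqW km) // ltW // lt_min e0 psi_gt0.
have m0 : (0 < m)%N by apply: leq_ltn_trans (ltn_ord i1).
have close j n : (N <= n)%N -> `|x_ n - x_ (n.+1 + j * m)%N| <= 2 * e.
  move=> Nn; elim: j => [|j IHj].
    have := dm 1%N m0; rewrite le_min => /andP[de _].
    have := drift n 1%N Nn; rewrite addn1 mul0n addn0.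
    by lra.
  set s := `|x_ n - x_ (n.+1 + j * m)%N| in IHj *.
  have s0 : 0 <= s by exact: normr_ge0.
  have Tle : `|x_ n.+1 - x_ (n.+1 + j * m).+1| <= s - psi s.
    rewrite (x_rec n) (x_rec (n.+1 + j * m)%N).
    apply: T_pair (orbit_mem n) _.
    by have := orbit_mem (n.+1 + j * m); rewrite iter_ordSDM.
  (* Applying [T] advances both points by one. Going back from [n.+1] to [n] costs one step and
     completing the next turn costs [m.-1], so the total drift is [m] steps. *)
  have tail : `|x_ (n.+1 + j * m).+1 - x_ (n.+1 + j.+1 * m)%N| <= d *+ m.-1.
    have -> : (n.+1 + j.+1 * m = (n.+1 + j * m).+1 + m.-1)%N.
      by rewrite [RHS]addSnnS prednK // mulSn [(m + _)%N]addnC addnA.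
    by apply: drift; rewrite addSn !leqW // (leq_trans Nn) // leq_addr.
  have := dm m (leqnn m); rewrite -{1}(prednK m0) mulrSr le_min => /andP[dme dmp].
  have := stepN n Nn => step.
  have tri : `|x_ n - x_ (n.+1 + j.+1 * m)%N| <= s - psi s + d *+ m.-1 + d.
    apply: le_trans (ler_distD (x_ n.+1) _ _) _.
    rewrite [leRHS]addrC; apply: lerD; first exact: ltW.
    apply: le_trans (ler_distD (x_ (n.+1 + j * m).+1) _ _) _.
    exact: lerD.
  (* If [s >= e], the loss [psi s >= psi e] absorbs the drift and the bound [2 * e] on [s] persists;
     if [s < e], the drift adds at most [e]. *)
  have [es|se] := leP e s.
    by have := psi_mono (ltW e0) es; lra.
  by have := le_trans psi0 (psi_mono (lexx 0) s0); lra.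
exists N => n [|k] Nn; first by rewrite addn0 subrr normr0; lra.
(* Whole turns are covered by [close]; the remaining [k %% m < m] steps drift by at most a third
   [e]. *)
rewrite -addSnnS (divn_eq k m) addnA.
apply: le_trans (ler_distD (x_ (n.+1 + k %/ m * m)%N) _ _) _.
have := dm _ (ltnW (ltn_pmod k m0)); rewrite le_min => /andP[de _].
have := drift (n.+1 + k %/ m * m)%N (k %% m)%N.
rewrite addSn leqW ?(leq_trans Nn) ?leq_addr // => /(_ isT).
by have := close (k %/ m)%N n Nn; rewrite addSn; lra.
Qed.

End cyclic_orbit.

(** * Limit of the orbit, fixed point and uniqueness *)

Theorem theorem3p5 (R : realType) (X : completeNormedModType R)
    (X_unif_convex : uniformly_convex X)
    (m : nat) (m_gt0 : (0 < m)%N)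
    (A : 'I_m -> set X) (A_nonempty : forall i, A i !=set0)
    (p : \bar R) (p_ge1 : (1 <= p)%E)
    (phi : R -> R) (phi_ge0 : forall t, 0 <= t -> 0 <= phi t)
    (phi_incr : {in `[0, +oo[ &, {homo phi : s t / s < t}})
    (T : {fun \bigcup_i A i >-> \bigcup_i A i})
    (T_contr : cyclic_p_phi_contraction p phi A T)
    (x_ : nat -> X) (x0_A1 : A (Ordinal m_gt0) (x_ 0%N))
    (x_rec : forall n, x_ n.+1 = T (x_ n))
    (i0 : 'I_m) (Ai0_closed : closed (A i0)) (Ai0_convex : convex_set (A i0))
    (dp0 : dp_sets p A = 0) :
  exists x : X,
    [/\ (\bigcap_i A i) x,
        T x = x,
        forall y : X, (\bigcup_i A i) y -> T y = y -> y = x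
      & x_ n @[n --> \oo] --> x].
Proof.
have T_pair := cyclic_contraction_pair A_nonempty p_ge1 phi_incr T_contr dp0.
have [TA _] := T_contr.
pose psi t := phi t - phi 0.
have psi_gt0 t : 0 < t -> 0 < psi t.
  by move=> t0; rewrite subr_gt0 phi_incr // in_itv /= ?lexx // ltW.
have psi0 : 0 <= psi 0 by rewrite /psi subrr.
have psi_mono s t : 0 <= s -> s <= t -> psi s <= psi t.
  move=> s_ge0; rewrite le_eqVlt => /predU1P[-> //|st].
  by rewrite lerB // ltW // phi_incr // in_itv /= andbT // ltW // (le_lt_trans s_ge0).
have x_mem := orbit_mem TA x0_A1 x_rec.
(* A fixed point in one set is carried by [T] into the next one, hence all around the cycle. *)
have fixed_mem y : (\bigcup_i A i) y -> T y = y -> forall i, A i y.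
  move=> [i _ Ay] Ty j; have [n _ <-] := iter_ordS_ge i j 0.
  by elim: n => //= n IHn; rewrite -Ty; apply: TA; exists y.
have /cauchy_cvg/cvg_ex[x x_cvg] : cauchy (x_ n @[n --> \oo]).
  apply/cauchy_ballP => e e0.
  (* Two late terms each lie within [3 * (e / 7)] of [x_ N], so their distance is at most
     [6 * (e / 7) < e]. *)
  have e7 : 0 < e / 7 by rewrite divr_gt0.
  have [N xN] := orbit_close TA psi_mono psi_gt0 psi0 T_pair x0_A1 x_rec e7.
  exists ([set x_ n | n in [set n | (N <= n)%N]], [set x_ n | n in [set n | (N <= n)%N]]).
    by split; exists N => // n Nn; exists n.
  move=> [_ _] [[n /= /subnKC <- <-] [k /= /subnKC <- <-]].
  rewrite -ball_normE /=; apply: le_lt_trans (ler_distD (x_ N) _ _) _.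
  have := xN N (n - N)%N (leqnn _); have := xN N (k - N)%N (leqnn _).
  by rewrite [in X in _ -> X -> _]distrC; lra.
have x_near e : 0 < e -> exists N, forall n, (N <= n)%N -> `|x - x_ n| < e.
  move=> e0; move/cvgr_dist_lt : x_cvg => /(_ _ e0)[N _ xN].
  by exists N => n Nn; apply: xN.
have Ai0x : A i0 x.
  apply: Ai0_closed => B /x_cvg[N _ BN].
  have [n Nn nE] := iter_ordS_ge (Ordinal m_gt0) i0 N.
  by exists (x_ n); split; [rewrite -nE | apply: BN].
have Tx : T x = x.
  apply/eqP; rewrite -subr_eq0 -normr_le0; apply/ler_addgt0Pr => e e0.
  have e2 : 0 < e / 2 by rewrite divr_gt0.
  have [N xN] := x_near _ e2.
  (* Only [A i0] is known to contain [x] so far, so [x_ n] is picked in the set following it, where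
     [T_pair] bounds the distance from [T x] to [x_ n.+1]. *)
  have [n Nn nE] := iter_ordS_ge (Ordinal m_gt0) (ordS i0) N.
  have Axn : A (ordS i0) (x_ n) by rewrite -nE.
  have := T_pair _ _ _ Ai0x Axn; rewrite -x_rec => Txn.
  have := le_trans psi0 (psi_mono _ _ (lexx 0) (normr_ge0 (x - x_ n))).
  have := ler_distD (x_ n.+1) (T x) x; rewrite [`|x_ n.+1 - x|]distrC /psi.
  by have := xN n Nn; have := xN n.+1 (leqW Nn); lra.
have Ax i : A i x by apply: fixed_mem => //; exists i0.
(* Both fixed points lie in every set, so [T_pair] applies to [y] and [x] and leaves
   [psi |y - x| <= 0]. *)
exists x; split => // y Uy Ty; apply/eqP; rewrite -subr_eq0 -normr_eq0.
apply/eqP/le_anti; rewrite normr_ge0 andbT leNgt; apply/negP => /psi_gt0.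
by have := T_pair i0 _ _ (fixed_mem _ Uy Ty i0) (Ax _); rewrite Ty Tx /psi; lra.
Qed.
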